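(* Let $C$ be a nonempty closed convex subset of $X$, let $F\colon X\to Y\cup\{+\infty_Y\}$ be a proper $K$-convex mapping such that $y^*\circ F$ is lower semicontinuous for all $y^*\in Y^*$, and let $G\colon X\to Z\cup\{+\infty_Z\}$ be a proper $S$-convex and $S$-epi closed mapping. Let $A:=C\cap G^{-1}(-S)$ and assume that $A\cap\operatorname{dom}F\neq\emptyset$. Then $$\operatorname{epi}_K(F+I_A)^*=\operatorname{cl}\Big\{\bigcup_{T\in\mathcal{L}_+^w(S,K)}\Big[\bigcap_{v\in I_{-S}^*(T)}\big[\operatorname{epi}_K(F+I_C+T\circ G)^*+(0_{\mathcal{L}},v)\big]\Big]\Big\},$$ the closure being taken in $\mathcal{L}(X,Y)\times Y$.
   Context: $X,Y,Z$ are (real) locally convex Hausdorff topological vector spaces with topological duals $X^*,Y^*,Z^*$; $K\subset Y$ is a closed, pointed, convex cone with $\operatorname{int}K\neq\emptyset$; $S\subset Z$ is a nonempty closed convex cone. Order and infinite elements: for $y_1,y_2\in Y$, $y_1<_K y_2$ means $y_1-y_2\in-\operatorname{int}K$. $Y^\bullet:=Y\cup\{-\infty_Y,+\infty_Y\}$, where $\pm\infty_Y\notin Y$ and $-\infty_Y<_K y<_K+\infty_Y$ for all $y\in Y$ (hence also $-\infty_Y<_K+\infty_Y$). Conventions: $-(+\infty_Y)=-\infty_Y$, $-(-\infty_Y)=+\infty_Y$, $(+\infty_Y)+y=y+(+\infty_Y)=+\infty_Y$ for $y\in Y\cup\{+\infty_Y\}$, $(-\infty_Y)+y=y+(-\infty_Y)=-\infty_Y$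 for $y\in Y\cup\{-\infty_Y\}$. Analogous elements $\pm\infty_Z$ and conventions are used for $Z$ (ordered by $S$). Weak supremum: for $\emptyset\neq M\subset Y^\bullet$, $\operatorname{WSup}M$ is the set of $\bar v\in Y^\bullet$ such that $\bar v\not<_K v$ for all $v\in M$, and for every $\tilde v\in Y^\bullet$ with $\tilde v<_K\bar v$ there is $v\in M$ with $\tilde v<_K v$. Mappings: for $F\colon X\to Y^\bullet$, $\operatorname{dom}F=\{x\in X: F(x)\neq+\infty_Y\}$; $F$ is proper if $\operatorname{dom}F\neq\emptyset$ and $-\infty_Y\notin F(X)$; $\operatorname{epi}_KF=\{(x,y)\in X\times Y: y\in F(x)+K\}$; $F$ is $K$-convex if $\operatorname{epi}_KF$ is convex, and $K$-epi closed if it is closed. The same notions are used for $G$ with $(Z,S)$ in place of $(Y,K)$. For $y^*\in Y^*$, $(y^*\circ F)(x)=y^*(F(x))$ if $F(x)\in Y$ and $+\infty$ if $F(x)=+\infty_Y$. $\mathcal{L}(X,Y)$ is the space of continuous linear mappings $X\to Y$ with the topology of pointwise convergence; $0_{\mathcal{L}}$ is its zero element. The conjugate of $F$ is the set-valued map $F^*(L)=\operatorname{WSup}\{L(x)-F(x):x\in X\}$, $L\in\mathcal{L}(X,Y)$, and $\operatorname{epi}_KF^*=\{(L,y)\in\mathcal{L}(X,Y)\times Y: y\in F^*(L)+K\}$. For a set $D$ in $X$ (or in $Z$), $I_D(x)=0_Y$ if $x\in D$ and $I_D(x)=+\infty_Y$ otherwise; in particular, for $-S\subset Z$ and $T\in\mathcal{L}(Z,Y)$,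 $I_{-S}^*(T)=\operatorname{WSup}T(-S)$. For $T\in\mathcal{L}(Z,Y)$, $(T\circ G)(x)=T(G(x))$ if $G(x)\in Z$ and $+\infty_Y$ if $G(x)=+\infty_Z$. $\mathcal{L}_+^w(S,K)=\{T\in\mathcal{L}(Z,Y): T(S)\cap(-\operatorname{int}K)=\emptyset\}$. *)

(* Defs.v *)
From HB Require Import structures.
From mathcomp Require Import all_boot all_order all_algebra.
From mathcomp Require Import all_classical all_reals all_analysis.
Import numFieldNormedType.Exports.

Set Implicit Arguments.
Unset Strict Implicit.
Unset Printing Implicit Defensive.

Import Order.TTheory GRing.Theory Num.Theory.
Local Open Scope classical_set_scope.
Local Open Scope ring_scope.

(* The extended spaces Y \cup {-oo_Y, +oo_Y} are the library's \bar Y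
   (extended Y), with its addition and opposite, which agree with the
   conventions of vector optimization wherever those are defined (the
   library's extra value (+oo) + (-oo) = -oo is never used for proper maps). *)

Section CLinear.
Context (R : realType) (X Y : tvsType R).

Definition clinear_pred : {pred X -> Y} :=
  fun f => `[< linear f /\ continuous f >].

Record clinear := CLinear {
  clin_fun :> X -> Y;
  _ : clin_fun \in clinear_pred }.

HB.instance Definition _ := [isSub for clin_fun].
HB.instance Definition _ := [Choice of clinear by <:].

Lemma clinear_linear (L : clinear) : linear L.
Proof. by have /asboolP[] := valP L. Qed.

Lemma clinear_continuous (L : clinear) : continuous L.
Proof. by have /asboolP[] := valP L. Qed.

HB.instance Definition _ (L : clinear) :=
  GRing.isLinear.Build R X Y *:%R (clin_fun L) (@clinear_linear L).

Lemma clinear_submod_closed : submod_closed clinear_pred.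
Proof.
split.
  apply/asboolP; split; last exact: cst_continuous.
  by move=> a u v; rewrite scaler0 addr0.
move=> a f g /asboolP[lf cf] /asboolP[lg cg]; apply/asboolP; split.
  move=> b u v; rewrite !addrfctE !scalrfctE lf lg !scalerDr.
  by rewrite !scalerA (mulrC b a) addrACA.
move=> x; rewrite addrfctE scalrfctE.
have caf : continuous (fun y => a *: f y).
  move=> y; apply: (@continuous_comp X (R^o * Y)%type Y
    (fun y => (a, f y)) (fun z => z.1 *: z.2)); last exact: scale_continuous.
  by apply: (@cvg_pair _ _ _ _ (nbhs (a : R^o))); [exact: cvg_cst|exact: cf].
apply: (@continuous_comp X (Y * Y)%type Y
  (fun y => (a *: f y, g y)) (fun z => z.1 + z.2)); last exact: add_continuous.
by apply: cvg_pair; [exact: caf|exact: cg].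
Qed.

HB.instance Definition _ :=
  GRing.isSubmodClosed.Build R (X -> Y) clinear_pred clinear_submod_closed.
HB.instance Definition _ :=
  [SubChoice_isSubLmodule of clinear by <:].

(* topology of pointwise convergence *)
HB.instance Definition _ := Topological.copy clinear
  (initial_topology (clin_fun : clinear -> {ptws X -> Y})).

End CLinear.

(* [0 < t] rather than [0 <= t]: for nonempty closed sets the two conventions
   agree. *)
Definition is_cone (R : realType) (V : lmodType R) (K : set V) :=
  forall (t : R) x, 0 < t -> K x -> K (t *: x).

Definition pointed_cone (V : zmodType) (K : set V) :=
  K `&` [set - k | k in K] = [set 0].

Section Order.
Context (R : realType) (Y : tvsType R) (K : set Y).

Definition wlt (y1 y2 : \bar Y) : Prop :=
  match y1, y2 with
  | a%:E, b%:E => [set - k | k in K°] (a - b)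
  | a%:E, +oo%E => True
  | -oo%E, b%:E => True
  | -oo%E, +oo%E => True
  | _, _ => False
  end.

Definition WSup (M : set (\bar Y)) : set (\bar Y) :=
  [set v | (forall u, M u -> ~ wlt v u) /\
           (forall w, wlt w v -> exists2 u, M u & wlt w u)].

End Order.

Section Mappings.
Context (R : realType) (X V : tvsType R).
Implicit Types (F : X -> \bar V) (K : set V).

Definition edom F : set X := [set x | F x <> +oo%E].

Definition proper_map F := edom F !=set0 /\ ~ range F -oo%E.

Definition epi K F : set (X * V) :=
  [set p | exists2 k, K k & p.2%:E = (F p.1 + k%:E)%E].

Definition cone_convex K F := convex_set (epi K F).

Definition epi_closed K F := closed (epi K F).

Definition conjugate K F (L : clinear X V) : set (\bar V) :=
  WSup K (range (fun x => ((L x)%:E - F x)%E)).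

Definition epi_conjugate K F : set (clinear X V * V) :=
  [set p | exists2 v, conjugate K F p.1 v &
           exists2 k, K k & p.2%:E = (v + k%:E)%E].

Definition indicator (D : set X) : X -> \bar V :=
  fun x => if x \in D then 0%:E else +oo%E.

(* E + w, where w may have an infinite second component: only the points of
   the sum that lie in clinear X V * V are retained. *)
Definition translate (E : set (clinear X V * V)) (w : clinear X V * \bar V) :
    set (clinear X V * V) :=
  [set p | exists2 q, E q & p.1 = q.1 + w.1 /\ p.2%:E = (q.2%:E + w.2)%E].

End Mappings.

Definition weakly_positive (R : realType) (Z Y : tvsType R)
    (S : set Z) (K : set Y) : set (clinear Z Y) :=
  [set T : clinear Z Y | T @` S `&` [set - k | k in K°] = set0].

Definition feasible (R : realType) (X Z : tvsType R)
    (C : set X) (G : X -> \bar Z) (S : set Z) : set X :=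
  C `&` G @^-1` (EFin @` [set - s | s in S]).

(* Main.v *)
Require Import Defs.
From mathcomp Require Import all_boot all_order all_algebra.
From mathcomp Require Import all_classical all_reals all_analysis.
From mathcomp Require Import ring lra.
Import numFieldNormedType.Exports.
Import Order.TTheory GRing.Theory Num.Theory.
Local Open Scope classical_set_scope.
Local Open Scope ring_scope.

Set Implicit Arguments.
Unset Strict Implicit.
Unset Printing Implicit Defensive.

(** Both sides of the equality are described by inequalities that avoid weak
    suprema. Whenever H has a finite value and never takes the value -oo,

      (L, y) belongs to epi_K H^*  iff  L x - H x - y is never in int K

    ([epi_conjugateE]): a line in a direction of int K leaves the lower set
    generated by the values L x - H x at a point of their weak supremum
    ([WSup_line]). In particular epi_K H^* is closed
    ([epi_conjugate_closed]).

    The right-hand side is contained in the left-hand side ([multiplier_sub]).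
    At a feasible x the value T (G x) is one of those whose weak supremum is
    I_{-S}^*(T); since T is weakly positive these values are bounded above, so
    some v in I_{-S}^*(T) dominates T (G x), and the condition attached to
    that v gives the one required of (L, y) at x. The left-hand side being
    closed, the closure stays inside.

    Conversely, let (L, y) be in the left-hand side. As F + I_A is K-convex,
    Hahn-Banach yields a continuous functional phi, positive on int K, with
    phi (L x) - phi (F x) <= phi y for all feasible x ([scalarization]).
    This reduces the problem to scalar duality. The set E of all (x, z, r)
    with x in C, z in G x + S and phi (F x) <= r + phi (L x) - phi y is closed
    and convex, and its slice z = 0 lies in r >= 0. For finitely many x_j and
    eps > 0, [affine_minorant] provides functionals xi and zeta such that
    r >= xi x - zeta z - eps on E and |xi x_j| < eps. It is obtained from
    one separation argument: the point (0, 0, -eps) is separated from E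
    enlarged by long segments in the directions x_j, and a functional bounded
    below on such an enlargement must be small on each x_j.

    Finally choose e in int K with phi e = 1 and put L' = L + xi (.) e,
    T = zeta (.) e and y' = y + eps e. Applying phi turns the affine minorant
    into the statement that T is weakly positive and that (L', y') belongs to
    the T-th set of the union ([multiplier_in]). Pointwise convergence only
    controls finitely many x_j at a time, so (L', y') can be placed in any
    prescribed neighbourhood of (L, y) ([nbhs_pointwise]). *)

(** * Extending a cone to a half-space *)

(** Replaces the bundled coefficients of [convex_set] by plain scalars, in
    the open range 0 < t < 1 so that no degenerate case has to be treated. *)
Lemma convex_setE (R : realType) (V : lmodType R) (A : set V) :
  convex_set A <-> forall x y (t : R), 0 < t -> t < 1 -> A x -> A y ->
    A (t *: x + (1 - t) *: y).
Proof.
split=> [cA x y t t0 t1 Ax Ay|cA].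
  exact: (set_mem (cA x y (Itv01 (ltW t0) (ltW t1)) (mem_set Ax) (mem_set Ay))).
apply/convex_setW => x y /set_mem Ax /set_mem Ay k k0 k1; apply/mem_set.
exact: (cA x y k%:num).
Qed.

Section ConeExtension.
Context (R : realType) (V : lmodType R) (P : set V) (o : V).

Let conic (Q : set V) :=
  (forall x y, Q x -> Q y -> Q (x + y)) /\
  (forall (t : R) x, 0 < t -> Q x -> Q (t *: x)).

Hypotheses (P_conic : conic P) (P0 : ~ P 0) (Po : P o)
  (o_int : forall x, exists2 e : R, 0 < e & P (o + e *: x)).

Let admissible (Q : set V) :=
  conic Q /\ (forall x, Q x -> ~ P (- x)).

(** The cone -P is kept disjoint from a growing cone A; by maximality every x
    or its opposite is in A, i.e. A is a half-space up to its boundary. Indeed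
    if A cannot absorb x, then a + t x = - p for some t > 0, a in A or zero,
    and p in P, which puts - x in A. *)
Lemma maximal_cone : exists A : set V,
  [/\ conic A, P `<=` A, ~ A (- o) & forall x, A x \/ A (- x)].
Proof.
have [|A [[[AD AZ] AP] Amax]] := @Zorn_bigcup V admissible.
  move=> F Fadm Ftot; split; first split.
  - move=> x y [Q1 FQ1 Q1x] [Q2 FQ2 Q2y].
    have [Q12|Q21] := Ftot _ _ FQ1 FQ2.
      by exists Q2 => //; apply: (Fadm _ FQ2).1.1 => //; exact: Q12.
    by exists Q1 => //; apply: (Fadm _ FQ1).1.1 => //; exact: Q21.
  - move=> t x t0 [Q FQ Qx]; exists Q => //.
    exact: (Fadm _ FQ).1.2.
  - move=> x [Q FQ Qx]; exact: (Fadm _ FQ).2.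
have [PD PZ] := P_conic.
have A0P x : A x \/ x = 0 -> ~ P (- x).
  by move=> [/AP//|->]; rewrite oppr0.
have key x : A x \/ exists a p (t : R),
    [/\ A a \/ a = 0, P p, 0 < t & - x = t *: (a + p)].
  have [Ax|nAx] := pselect (A x); first by left.
  right.
  (* the cone generated by A and x; zero is allowed for a because A is not
     yet known to contain 0 *)
  pose B := [set b | exists a (t : R), [/\ A a \/ a = 0, 0 <= t & b = a + t *: x]].
  have AB : A `<` B.
    split; last first.
      by move=> BA; apply: nAx; apply: BA; exists 0, 1; split=> //;
        [right|rewrite add0r scale1r].
    by move=> a Aa; exists a, 0; split; [left| |rewrite scale0r addr0].
  apply: contrapT => nex; apply: (Amax _ AB); split; first split.
  - move=> _ _ [a [t [Aa t0 ->]]] [b [s [Ab s0 ->]]].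
    exists (a + b), (t + s); split; last by rewrite scalerDl addrACA.
    + case: Aa => [Aa|->]; last by rewrite add0r.
      by case: Ab => [Ab|->]; left; [exact: AD|rewrite addr0].
    + exact: addr_ge0.
  - move=> s _ s0 [a [t [Aa t0 ->]]].
    exists (s *: a), (s * t); split; last by rewrite scalerDr scalerA.
    + case: Aa => [Aa|->]; last by rewrite scaler0; right.
      by left; exact: AZ.
    + by rewrite mulr_ge0// ltW.
  - move=> _ [a [t [Aa t0 ->]]] Pp.
    have [t00|tn0] := eqVneq t 0.
      by move: Pp; rewrite t00 scale0r addr0; exact: A0P.
    apply: nex; exists a, (- (a + t *: x)), t^-1; split=> //.
      by rewrite invr_gt0 lt_neqAle eq_sym tn0.
    by rewrite opprD addrA subrr add0r scalerN scalerA mulVf// scale1r.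
have PA : P `<=` A.
  move=> p Pp; have [//|[a [q [t [Aa Pq t0 pE]]]]] := key p.
  exfalso; apply: (A0P _ Aa).
  have -> : - a = q + t^-1 *: p.
    rewrite -[p in RHS]opprK pE scalerN scalerA mulVf ?gt_eqF// scale1r.
    by rewrite opprD addrCA subrr addr0.
  by apply: PD => //; apply: PZ => //; rewrite invr_gt0.
exists A; split=> //.
  by move=> /AP; rewrite opprK.
move=> x; have [|[a [p [t [Aa Pp t0 ->]]]]] := key x; first by left.
right; apply: AZ => //.
by case: Aa => [Aa|->]; [apply: AD => //; exact: PA|rewrite add0r; exact: PA].
Qed.

(** Hahn-Banach extension without sublinear functionals: f x is the unique
    cut between the t with x - t o in the half-space A of [maximal_cone] and
    the t with t o - x in A. Uniqueness of the cut makes f linear, and the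
    interiority of o makes it finite. *)
Lemma cone_positive_functional : exists f : V -> R,
  [/\ linear (f : V -> R^o), f o = 1 & forall x, P x -> 0 <= f x].
Proof.
have [A [[AD AZ] PA nAo Atot]] := maximal_cone.
have Ao : A o := PA _ Po.
have A0 : A 0 by have [|] := Atot 0; rewrite ?oppr0.
have Apos (t : R) : 0 <= t -> A (t *: o).
  rewrite le_eqVlt => /orP[/eqP<-|t0]; first by rewrite scale0r.
  exact: AZ.
have Aneg (t : R) : A (t *: o) -> 0 <= t.
  move=> Ato; rewrite leNgt; apply/negP => t0; apply: nAo.
  have -> : - o = (- t^-1) *: (t *: o).
    by rewrite scalerA mulNr mulVf ?lt_eqF// scaleN1r.
  by apply: AZ => //; rewrite oppr_gt0 invr_lt0.
pose cut x c := (forall t, t < c -> A (x - t *: o)) /\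
                (forall t, c < t -> A (t *: o - x)).
have cutD x y c d : cut x c -> cut y d -> cut (x + y) (c + d).
  move=> [xl xr] [yl yr]; split=> t tcd.
    have -> : x + y - t *: o = (x - (c - (c + d - t) / 2) *: o)
                             + (y - (d - (c + d - t) / 2) *: o).
      rewrite addrACA -opprD -scalerDl; congr (_ - _ *: _); lra.
    by apply: AD; [apply: xl|apply: yl]; lra.
  have -> : t *: o - (x + y) = ((c + (t - c - d) / 2) *: o - x)
                             + ((d + (t - c - d) / 2) *: o - y).
    rewrite addrACA -opprD -scalerDl; congr (_ *: _ - _); lra.
  by apply: AD; [apply: xr|apply: yr]; lra.
have cutN x c : cut x c -> cut (- x) (- c).
  move=> [xl xr]; split=> t tc.
    have -> : - x - t *: o = (- t) *: o - x by rewrite scaleNr addrC.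
    by apply: xr; lra.
  have -> : t *: o - - x = x - (- t) *: o by rewrite scaleNr !opprK addrC.
  by apply: xl; lra.
have cutP x c (a : R) : 0 < a -> cut x c -> cut (a *: x) (a * c).
  move=> a0 [xl xr]; split=> t tc.
    have -> : a *: x - t *: o = a *: (x - (a^-1 * t) *: o).
      by rewrite scalerBr scalerA mulrA mulfV ?gt_eqF// mul1r.
    by apply: AZ => //; apply: xl; rewrite mulrC ltr_pdivrMr// mulrC.
  have -> : t *: o - a *: x = a *: ((a^-1 * t) *: o - x).
    by rewrite scalerBr scalerA mulrA mulfV ?gt_eqF// mul1r.
  by apply: AZ => //; apply: xr; rewrite mulrC ltr_pdivlMr// mulrC.
have cut0 : cut 0 0.
  split=> t t0; rewrite ?sub0r ?subr0 -?scaleNr; apply: Apos; lra.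
have cutZ x c (a : R) : cut x c -> cut (a *: x) (a * c).
  move=> xc; have [a0|a0|->] := ltgtP a 0.
  - rewrite -[a]opprK scaleNr mulNr; apply: cutN; apply: cutP => //.
    by rewrite oppr_gt0.
  - exact: cutP.
  - by rewrite scale0r mul0r.
have cut_le x c d : cut x c -> cut x d -> c <= d.
  move=> [xl _] [_ xr]; rewrite leNgt; apply/negP => dc.
  have /Aneg : A ((d + (c - d) / 3 - (d + (c - d) / 3 * 2)) *: o).
    have -> : (d + (c - d) / 3 - (d + (c - d) / 3 * 2)) *: o =
      ((d + (c - d) / 3) *: o - x) + (x - (d + (c - d) / 3 * 2) *: o).
      by rewrite addrA subrK scalerBl.
    by apply: AD; [apply: xr|apply: xl]; lra.
  lra.
have cut_uniq x c d : cut x c -> cut x d -> c = d.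
  by move=> xc xd; apply/eqP; rewrite eq_le !(cut_le x).
have cut_ex x : exists c, cut x c.
  pose D := [set t | A (x - t *: o)].
  have Ddown s t : s <= t -> D t -> D s.
    move=> st Dt; rewrite /D /=.
    have -> : x - s *: o = (x - t *: o) + (t - s) *: o.
      by rewrite scalerBl addrA subrK.
    by apply: AD => //; apply: Apos; lra.
  have supD : has_sup D.
    split.
      have [e e0 Pe] := o_int x; exists (- e^-1); rewrite /D /=.
      have -> : x - (- e^-1) *: o = e^-1 *: (o + e *: x).
        rewrite scaleNr opprK scalerDr scalerA mulVf ?gt_eqF// scale1r.
        by rewrite addrC.
      by apply: AZ; [rewrite invr_gt0|exact: PA].
    have [e e0 Pe] := o_int (- x); exists e^-1 => t Dt.
    have /Aneg : A ((e^-1 - t) *: o); last by lra.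
    have -> : (e^-1 - t) *: o = e^-1 *: (o + e *: - x) + (x - t *: o).
      rewrite scalerDr scalerA mulVf ?gt_eqF// scale1r scalerBl.
      by rewrite addrA subrK.
    by apply: AD => //; apply: AZ; [rewrite invr_gt0|exact: PA].
  exists (sup D); split=> t tc.
    have tc' : 0 < sup D - t by lra.
    have [s Ds ts] := sup_adherent tc' supD.
    by apply: (Ddown t s _ Ds); lra.
  have [|//] := Atot (x - t *: o); last by rewrite opprB.
  move=> Dt; have := ub_le_sup supD.2 Dt; lra.
pose f x := sval (cid (cut_ex x)).
have fP x : cut x (f x) by exact: (svalP (cid (cut_ex x))).
exists f; split.
- move=> a x y; apply: (cut_uniq _ _ _ (fP _)).
  by apply: cutD => //; exact: cutZ.
- apply: (cut_uniq _ _ _ (fP _)); split=> t t1.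
    by rewrite -[X in X - _]scale1r -scalerBl; apply: Apos; lra.
  by rewrite -[X in _ - X]scale1r -scalerBl; apply: Apos; lra.
- move=> x Px; rewrite leNgt; apply/negP => fx0.
  have /Aneg : A ((f x / 2) *: o); last by lra.
  rewrite -[X in A X](subrK x); apply: AD; last exact: PA.
  by apply: (fP x).2; lra.
Qed.

End ConeExtension.

(** * Hahn-Banach separation in locally convex spaces *)

Lemma continuous_pair (T U V : topologicalType) (f : T -> U) (g : T -> V) :
  continuous f -> continuous g -> continuous (fun x => (f x, g x)).
Proof. by move=> cf cg x; apply: cvg_pair; [exact: cf|exact: cg]. Qed.

Section TvsContinuity.
Context (R : realType) (T : topologicalType) (V : tvsType R).

Lemma tvs_continuousD (f g : T -> V) :
  continuous f -> continuous g -> continuous (fun x => f x + g x).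
Proof.
move=> cf cg x; apply: (@continuous_comp T (V * V)%type V
  (fun y => (f y, g y)) (fun z => z.1 + z.2)); last exact: add_continuous.
by apply: cvg_pair; [exact: cf|exact: cg].
Qed.

Lemma tvs_continuousZ (a : T -> R^o) (f : T -> V) :
  continuous a -> continuous f -> continuous (fun x => a x *: f x).
Proof.
move=> ca cf x; apply: (@continuous_comp T (R^o * V)%type V
  (fun y => (a y, f y)) (fun z => z.1 *: z.2)); last exact: scale_continuous.
by apply: (@cvg_pair _ _ _ _ (nbhs (a x : R^o))); [exact: ca|exact: cf].
Qed.

Lemma tvs_continuousB (f g : T -> V) :
  continuous f -> continuous g -> continuous (fun x => f x - g x).
Proof.
move=> cf cg; apply: tvs_continuousD => //.
have -> : (fun x => - g x) = (fun x => (-1 : R^o) *: g x).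
  by apply/funext => x; rewrite scaleN1r.
by apply: tvs_continuousZ => //; exact: cst_continuous.
Qed.

End TvsContinuity.

Section Separation.
Context (R : realType) (V : tvsType R).

Lemma clinear_exists (W : tvsType R) (f : V -> W) :
  linear f -> continuous f -> exists L : clinear V W, L =1 f.
Proof.
move=> lf cf; have fP : f \in @clinear_pred R V W by apply/asboolP.
by exists (CLinear fP).
Qed.

(** Neighbourhoods are absorbing; stated for a whole segment so that two
    such conditions can be met by one parameter. *)
Lemma nbhs_segment (x d : V) (O : set V) : nbhs x O ->
  exists2 e : R, 0 < e & forall a : R, `|a| < e -> O (x + a *: d).
Proof.
move=> Ox.
have cl : continuous (fun a : R^o => x + a *: d).
  apply: tvs_continuousD; first exact: cst_continuous.
  by apply: tvs_continuousZ; [by move=> ?; exact: cvg_id|exact: cst_continuous].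
have /= := cl 0 O; rewrite scale0r addr0 => /(_ Ox).
rewrite nbhs_simpl /= => /nbhs_ballP[e /= e0 eO]; exists e => // a ae.
by apply: eO; rewrite /ball /= sub0r normrN.
Qed.

Lemma nbhs_line (x d : V) (O : set V) : nbhs x O ->
  exists2 e : R, 0 < e & O (x + e *: d).
Proof.
move=> /nbhs_segment-/(_ d)[e e0 eO]; exists (e / 2); first by lra.
by apply: eO; rewrite gtr0_norm; lra.
Qed.

(** Positivity on x0 + U and x0 - U bounds |f| by f x0 on a neighbourhood of
    0, and a linear functional bounded near 0 is continuous. *)
Lemma positive_on_open_continuous (f : V -> R^o) (O : set V) (x0 : V) :
  linear f -> nbhs x0 O -> (forall x, O x -> 0 < f x) -> continuous f.
Proof.
move=> lf Ox0 fpos y.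
have f0 : 0 < f x0 by apply: fpos; exact: nbhs_singleton.
apply/cvgrPdist_lt => e e0.
have c1 : continuous (fun z : V => x0 + (f x0 / e : R^o) *: (z - y)).
  apply: tvs_continuousD; first exact: cst_continuous.
  apply: tvs_continuousZ; first exact: cst_continuous.
  apply: tvs_continuousB; last exact: cst_continuous.
  by move=> z; exact: cvg_id.
have c2 : continuous (fun z : V => x0 - (f x0 / e : R^o) *: (z - y)).
  apply: tvs_continuousB; first exact: cst_continuous.
  apply: tvs_continuousZ; first exact: cst_continuous.
  apply: tvs_continuousB; last exact: cst_continuous.
  by move=> z; exact: cvg_id.
have /= := c1 y O; rewrite subrr scaler0 addr0 => /(_ Ox0) n1.
have /= := c2 y O; rewrite subrr scaler0 subr0 => /(_ Ox0) n2.
near=> z.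
have /fpos : O (x0 + (f x0 / e) *: (z - y)) by near: z.
have /fpos : O (x0 - (f x0 / e) *: (z - y)) by near: z.
have fE (a : R) : f (x0 + a *: (z - y)) = f x0 + a * (f z - f y).
  have fB : f (z - y) = f z - f y.
    by rewrite addrC -scaleN1r lf scaleN1r addrC.
  by rewrite addrC lf fB addrC.
rewrite -scaleNr !fE.
have -> : f x0 + - (f x0 / e) * (f z - f y) = f x0 / e * (e - (f z - f y)).
  by field; rewrite gt_eqF.
have -> : f x0 + f x0 / e * (f z - f y) = f x0 / e * (e + (f z - f y)).
  by field; rewrite gt_eqF.
have fe : 0 < f x0 / e by exact: divr_gt0.
rewrite !(pmulr_rgt0 _ fe) => h1 h2.
by rewrite ltr_norml; apply/andP; split; lra.
Unshelve. all: by end_near. Qed.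

(** The convex cone generated by O avoids 0, and each of its points in O is
    interior, so the functional of [cone_positive_functional] is strictly
    positive on O. *)
Lemma open_convex_separation (O : set V) : open O -> convex_set O ->
  O !=set0 -> ~ O 0 -> exists phi : clinear V R^o, forall x, O x -> 0 < phi x.
Proof.
move=> Oo /convex_setE Oc [w Ow] O0.
pose P := [set x | exists2 t : R, 0 < t & (exists2 y, O y & x = t *: y)].
have OP x : O x -> P x by move=> Ox; exists 1 => //; exists x; rewrite ?scale1r.
have OPe x d : O x -> exists2 e : R, 0 < e & P (x + e *: d).
  move=> Ox; have [e e0 Oe] : exists2 e : R, 0 < e & O (x + e *: d).
    by apply: nbhs_line; exact: open_nbhs_nbhs.
  by exists e => //; exact: OP.
have [||||f [lf fo fP]] := @cone_positive_functional R V P w.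
- split.
    move=> _ _ [t t0 [x Ox ->]] [s s0 [y Oy ->]].
    have ts0 : 0 < t + s by rewrite addr_gt0.
    exists (t + s) => //.
    exists ((t / (t + s)) *: x + (1 - t / (t + s)) *: y).
      apply: Oc => //; first by rewrite divr_gt0.
      by rewrite ltr_pdivrMr//; lra.
    rewrite scalerDr !scalerA; congr (_ *: _ + _ *: _); field; lra.
  move=> t _ t0 [s s0 [x Ox ->]]; exists (t * s); first exact: mulr_gt0.
  by exists x => //; rewrite scalerA.
- move=> [t t0 [x Ox /esym/eqP]]; rewrite scaler_eq0 gt_eqF//= => /eqP x0.
  by apply: O0; rewrite -x0.
- exact: OP.
- by move=> x; exact: OPe.
have fpos x : O x -> 0 < f x.
  move=> Ox; have [e e0 /fP] := OPe x (- w) Ox.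
  have f0 : f 0 = 0 by have := lf (-1) 0 0; rewrite scaler0 addr0 scaleN1r addNr.
  have fN : f (- w) = - 1.
    by have := lf (-1) w 0; rewrite addr0 scaleN1r f0 addr0 fo scaleN1r.
  by rewrite addrC lf fN scalerN -[e *: _]/(e * 1) => ?; lra.
have [phi phiE] := clinear_exists lf (positive_on_open_continuous lf
  (open_nbhs_nbhs (conj Oo Ow)) fpos).
by exists phi => x Ox; rewrite phiE; exact: fpos.
Qed.

(** Separates E - b from 0, where b is a convex open neighbourhood of q that
    misses E; moving slightly from q inside b leaves room for the gap. *)
Lemma closed_convex_separation (E : set V) (q : V) : closed E ->
  convex_set E -> E !=set0 -> ~ E q ->
  exists phi : clinear V R^o, exists2 c : R, phi q < c &
    forall x, E x -> c <= phi x.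
Proof.
move=> Ecl /convex_setE Ec [e0 Ee0] Eq.
have [B Bconv [Bo Bb]] := @locally_convex R V.
have nq : nbhs q (~` E).
  by apply: open_nbhs_nbhs; split => //; exact: closed_openC.
have [b [Bb1 bq] bE] := Bb q _ nq.
have /convex_setE bc := Bconv b (mem_set Bb1).
pose O := [set x | exists2 e, E e & b (e - x)].
have [||||phi phiO] := @open_convex_separation O.
- rewrite openE => x [e Ee bex].
  have cb : continuous (fun z : V => e - z).
    apply: tvs_continuousB; first exact: cst_continuous.
    by move=> z; exact: cvg_id.
  have nb : nbhs (e - x) b by apply: open_nbhs_nbhs; split => //; exact: Bo.
  have nz : nbhs x [set z | b (e - z)] := cb x b nb.
  by apply: filterS nz => z bz; exists e.
- apply/convex_setE => x y t t0 t1 [e Ee bx] [f Ef b_y].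
  exists (t *: e + (1 - t) *: f); first exact: Ec.
  have -> : t *: e + (1 - t) *: f - (t *: x + (1 - t) *: y) =
            t *: (e - x) + (1 - t) *: (f - y).
    by rewrite !scalerBr opprD addrACA.
  exact: bc.
- by exists (e0 - q), e0 => //; rewrite opprB addrC subrK.
- by move=> [e Ee]; rewrite subr0 => /bE; apply.
have phid : 0 < phi (e0 - q).
  by apply: phiO; exists e0 => //; rewrite opprB addrC subrK.
have [|e e_gt0 bqe] := @nbhs_line q (e0 - q) b.
  by apply: open_nbhs_nbhs; split => //; exact: Bo.
exists phi, (phi (q + e *: (e0 - q))).
  by rewrite linearD linearZ /= ltrDl mulr_gt0.
move=> x Ex; rewrite -subr_ge0 -linearB /=; apply: ltW; apply: phiO.
by exists x => //; rewrite opprB addrC subrK.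
Qed.

End Separation.

(** * An affine minorant that is small in finitely many directions *)

Section Thickening.
Context (R : realType) (V : tvsType R).

(** The Minkowski sum of E and the segment [-N d, N d]. *)
Definition thicken (N : R) (d : V) (E : set V) : set V :=
  [set p | exists2 a : R, -N <= a <= N & E (p + a *: d)].

(** The sum of a closed set and a compact segment is closed: the points of
    the segment that miss E are handled uniformly near p by compactness. *)
Lemma thicken_closed (N : R) (d : V) (E : set V) :
  closed E -> closed (thicken N d E).
Proof.
move=> Ecl; rewrite -openC openE => p nEp.
have /compact_near_coveringP cov : compact (`[- N, N]%classic : set R^o).
  exact: segment_compact.
pose P (i : V) (x : R^o) := ~ E (i + x *: d).
have cP : forall x : R^o, `[- N, N]%classic x ->
    \forall x' \near x & i \near p, P i x'.
  move=> x xN.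
  have cc : continuous (fun z : R^o * V => z.2 + z.1 *: d).
    apply: tvs_continuousD; first by move=> z; exact: cvg_snd.
    apply: tvs_continuousZ; first by move=> z; exact: cvg_fst.
    exact: cst_continuous.
  have nE : nbhs (p + x *: d) (~` E).
    apply: open_nbhs_nbhs; split; first exact: closed_openC.
    by move=> Ex; apply: nEp; exists x => //; move: xN; rewrite /= in_itv.
  exact: (cc (x, p) _ nE).
have nP : nbhs p [set i | `[- N, N]%classic `<=` P i] :=
  cov V (nbhs p) P (nbhs_filter p) cP.
suff : nbhs p (~` thicken N d E) by [].
apply: filterS nP => i Pi [a aN Ea].
by apply: (Pi a) Ea; rewrite /= in_itv.
Qed.

Lemma thicken_convex (N : R) (d : V) (E : set V) :
  convex_set E -> convex_set (thicken N d E).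
Proof.
move=> /convex_setE Ec; apply/convex_setE => x y t t0 t1.
move=> [a /andP[aN1 aN2] Ea] [b /andP[bN1 bN2] Eb].
exists (t * a + (1 - t) * b); first by apply/andP; split; nra.
have -> : t *: x + (1 - t) *: y + (t * a + (1 - t) * b) *: d =
          t *: (x + a *: d) + (1 - t) *: (y + b *: d).
  by rewrite (scalerDl d) !scalerDr !scalerA addrACA.
exact: Ec.
Qed.

Lemma sub_thicken (N : R) (d : V) (E : set V) : 0 <= N -> E `<=` thicken N d E.
Proof.
by move=> N0 p Ep; exists 0; rewrite ?scale0r ?addr0//; apply/andP; split; lra.
Qed.

(** A functional bounded below by c on E + [-N d, N d] must absorb the
    variation N |phi d| inside its values on E; for large N this forces phi d
    to be small. *)
Lemma thicken_lower_bound (N : R) (d : V) (E : set V)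
    (phi : clinear V R^o) (c : R) : 0 <= N ->
  (forall p, thicken N d E p -> c <= phi p) ->
  forall p, E p -> c + N * `|phi d| <= phi p.
Proof.
move=> N0 cE p Ep.
have h1 : c <= phi (p - N *: d).
  by apply: cE; exists N; rewrite ?subrK//; apply/andP; split; lra.
have h2 : c <= phi (p + N *: d).
  by apply: cE; exists (- N); rewrite ?scaleNr ?addrK//; apply/andP; split; lra.
move: h1 h2; rewrite linearB linearD linearZ /= /GRing.scale /= => h1 h2.
have [d0|d0] := ger0P (phi d : R); first by lra.
by rewrite mulrN; lra.
Qed.

Definition thicken_seq (N : R) (ds : seq V) (E : set V) : set V :=
  foldr (thicken N) E ds.

Lemma thicken_seq_closed (N : R) (ds : seq V) (E : set V) :
  closed E -> closed (thicken_seq N ds E).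
Proof. by move=> Ecl; elim: ds => //= d ds IH; exact: thicken_closed. Qed.

Lemma thicken_seq_convex (N : R) (ds : seq V) (E : set V) :
  convex_set E -> convex_set (thicken_seq N ds E).
Proof. by move=> Ec; elim: ds => //= d ds IH; exact: thicken_convex. Qed.

Lemma sub_thicken_seq (N : R) (ds : seq V) (E : set V) :
  0 <= N -> E `<=` thicken_seq N ds E.
Proof.
move=> N0; elim: ds => //= d ds IH.
by apply: subset_trans IH _; exact: sub_thicken.
Qed.

Lemma thicken_seq_lower_bound (N : R) (ds : seq V) (E : set V)
    (phi : clinear V R^o) (c : R) : 0 <= N ->
  (forall p, thicken_seq N ds E p -> c <= phi p) ->
  forall p d, E p -> d \in ds -> c + N * `|phi d| <= phi p.
Proof.
move=> N0; elim: ds => //= d ds IH cE p d' Ep.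
have cE' := thicken_lower_bound N0 cE.
rewrite in_cons => /predU1P[->|]; first by apply: cE'; exact: sub_thicken_seq.
apply: IH => // p' Ep'; apply: cE; exact: sub_thicken.
Qed.

End Thickening.

Lemma triple_eq (A B C : Type) (p q : A * B * C) :
  p.1.1 = q.1.1 -> p.1.2 = q.1.2 -> p.2 = q.2 -> p = q.
Proof. by case: p q => [[a b] c] [[a' b'] c'] /= -> -> ->. Qed.

(** The heart of the duality. The separating functional phi has a positive
    coefficient b on r because both (0, 0, r0) and (0, 0, -eps) are compared
    on the vertical axis, (0, 0, r0) being in the enlargement thanks to the
    direction x0. It is small on the x_j by [thicken_seq_lower_bound]; dividing
    by - b gives xi, and by b gives zeta. *)
Lemma affine_minorant (R : realType) (X Z : tvsType R)
    (E : set (X * Z * R^o)) (x0 : X) (r0 : R) (xs : seq X) (eps : R) :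
  closed E -> convex_set E -> E (x0, 0, r0) ->
  (forall x r, E (x, 0, r) -> 0 <= r) -> 0 < eps ->
  exists (xi : clinear X R^o) (zeta : clinear Z R^o),
    (forall x z r, E (x, z, r) -> xi x - zeta z - eps <= r) /\
    (forall x, x \in xs -> `|xi x| < eps).
Proof.
move=> Ecl Ec E0 Epos eps0.
have r00 : 0 <= r0 := Epos _ _ E0.
(* N >= 2 controls phi on x0 by (r0 + eps) b; the second summand brings phi
   on each x_j below eps b *)
pose N := 2 + 2 * (r0 + eps) / eps.
have N2 : 2 <= N by rewrite /N lerDl divr_ge0//; lra.
have N0 : 0 <= N by lra.
pose ix (x : X) : X * Z * R^o := (x, 0, 0).
pose ds := [seq ix x | x <- x0 :: xs].
pose E' := thicken_seq N ds E.
have E'E p : E' p -> exists x, E (x, p.1.2, p.2).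
  rewrite /E' /ds; elim: (x0 :: xs) p => [[[x z] r] /= Ep|x s IH p /=].
    by exists x.
  move=> [a _ /IH[y]]; rewrite /= !scaler0 !addr0 => Ey; by exists y.
have [||||phi [c qc cE']] := @closed_convex_separation R _ E' (0, 0, - eps).
- exact: thicken_seq_closed.
- exact: thicken_seq_convex.
- by exists (x0, 0, r0); exact: sub_thicken_seq.
- by move=> /E'E[x /= /Epos]; lra.
pose b := phi (0, 0, 1).
have phiE x z r : phi (x, z, r) = phi (ix x) + phi (0, z, 0) + r * b.
  rewrite /b -[r * _]/(r *: (phi _ : R^o)) -linearZ -!linearD; congr (phi _).
  by apply: triple_eq; rewrite /= ?scaler0 ?scaler0 ?addr0 ?addr0 ?add0r ?add0r//; exact/esym/mulr1.
have phi0 : phi (0, 0, 0) = 0 by exact: linear0.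
have phi00 r : phi (0, 0, r) = r * b.
  by rewrite (phiE 0 0 r) /ix !phi0 !add0r.
have phix r : phi (x0, 0, r) = phi (ix x0) + r * b.
  by rewrite (phiE x0 0 r) !phi0 addr0.
have bpos : 0 < b.
  have E'0 : E' (0, 0, r0).
    exists 1; first by apply/andP; split; lra.
    apply: sub_thicken_seq => //.
    have -> : (0, 0, r0) + 1 *: ix x0 = (x0, 0, r0) :> X * Z * R^o.
      by apply: triple_eq; rewrite /= scale1r ?add0r ?addr0.
    exact: E0.
  have := cE' _ E'0; move: qc; rewrite !phi00 => qc cr.
  by have : 0 < (r0 + eps) * b; [lra|rewrite pmulr_rgt0//; lra].
have bound x : x \in x0 :: xs -> `|phi (ix x)| < eps * b.
  have lb := thicken_seq_lower_bound N0 cE' E0.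
  have lb0 := lb (ix x0) (map_f _ (mem_head _ _)).
  move=> xs_x; have lbx := lb (ix x) (map_f _ xs_x).
  move: qc lb0 lbx; rewrite phi00 (phix r0) => qc lb0 lbx.
  have le0 := ler_norm (phi (ix x0)).
  have n0 := normr_ge0 (phi (ix x0)).
  have nx := normr_ge0 (phi (ix x)).
  (* the value of phi at (x0, 0, r0) bounds every N |phi (ix x)|, up to the
     unknown phi (ix x0), which is bounded first by taking x = x0 *)
  have m0 : `|phi (ix x0)| <= (r0 + eps) * b by nra.
  have mx : N * `|phi (ix x)| <= 2 * (r0 + eps) * b by nra.
  have Ne : N * eps = 2 * eps + 2 * (r0 + eps) by rewrite /N; field; lra.
  rewrite -(@ltr_pM2l _ N); last by lra.
  rewrite mulrA Ne; nra.
have cont_id (T : topologicalType) : continuous (fun x : T => x).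
  by move=> x; exact: cvg_id.
have contix : continuous (fun x : X => phi (ix x)).
  move=> x; apply: (@continuous_comp X _ R^o ix phi); last first.
    exact: clinear_continuous.
  apply: continuous_pair; last exact: cst_continuous.
  by apply: continuous_pair => //; exact: cst_continuous.
have contiz : continuous (fun z : Z => phi (0, z, 0)).
  move=> z; apply: (@continuous_comp Z _ R^o (fun z => (0, z, 0)) phi).
    apply: continuous_pair; last exact: cst_continuous.
    by apply: continuous_pair => //; exact: cst_continuous.
  exact: clinear_continuous.
have [||xi xiE] := @clinear_exists R X R^o (fun x => (- b^-1) *: (phi (ix x) : R^o)).
- move=> a x y; rewrite scalerA mulrC -scalerA -scalerDr; congr (_ *: _).
  rewrite -linearZ -linearD; congr (phi _).
  by apply: triple_eq; rewrite /= ?scaler0 ?scaler0 ?addr0 ?addr0 ?add0r.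
- by apply: tvs_continuousZ => //; exact: cst_continuous.
have [||zeta zetaE] := @clinear_exists R Z R^o (fun z => b^-1 *: (phi (0, z, 0) : R^o)).
- move=> a x y; rewrite scalerA mulrC -scalerA -scalerDr; congr (_ *: _).
  rewrite -linearZ -linearD; congr (phi _).
  by apply: triple_eq; rewrite /= ?scaler0 ?scaler0 ?addr0 ?addr0 ?add0r.
- by apply: tvs_continuousZ => //; exact: cst_continuous.
exists xi, zeta; split=> [x z r Exzr|x xs_x].
  have := cE' _ (sub_thicken_seq ds N0 Exzr).
  rewrite xiE zetaE /GRing.scale /=; move: qc; rewrite phi00 (phiE x z r) => qc cr.
  rewrite -(ler_pM2r bpos) !mulrBl mulrAC mulNr mulVf ?gt_eqF// mulrAC mulVf ?gt_eqF//.
  lra.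
rewrite xiE /GRing.scale /= normrM normrN normfV (gtr0_norm bpos).
rewrite mulrC ltr_pdivrMr//; apply: bound; rewrite in_cons xs_x; exact: orbT.
Qed.

(** * Pointwise convergence of continuous linear maps *)

(** Perturbing L by xi (.) e moves each value L x along the line through e,
    so L' enters a pointwise neighbourhood of L once xi is small at finitely
    many points. The perturbations that are small at more and more points form
    a filter converging pointwise to L, which spares a description of the basic
    open sets of the product topology. *)
Lemma nbhs_pointwise (R : realType) (X Y : tvsType R) (L : clinear X Y)
    (e : Y) (A : set (clinear X Y)) : nbhs L A ->
  exists (xs : seq X) (eps : R), 0 < eps /\
    forall (xi : X -> R) (L' : clinear X Y),
      (forall x, x \in xs -> `|xi x| < eps) ->
      (forall x, L' x = L x + xi x *: e) -> A L'.
Proof.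
move=> [_ [[B Bo <-] BL BA]].
have nB : nbhs (clin_fun L : {ptws X -> Y}) B by apply: open_nbhs_nbhs.
pose W (p : seq X * R) : set {ptws X -> Y} :=
  [set g | exists2 xi : X -> R, (forall x, x \in p.1 -> `|xi x| < p.2) &
             forall x, g x = L x + xi x *: e].
pose Fil : set_system {ptws X -> Y} := filter_from [set p | 0 < p.2] W.
have FF : Filter Fil.
  apply: filter_from_filter; first by exists ([::], 1) => /=.
  move=> [xs a] [ys b] /= a0 b0; exists (xs ++ ys, Num.min a b).
    by rewrite /= lt_min a0.
  move=> g [xi xi_lt gE]; split; exists xi => //= x xP.
    by have := xi_lt x; rewrite /= mem_cat xP lt_min => /(_ isT)/andP[].
  by have := xi_lt x; rewrite /= mem_cat xP orbT lt_min => /(_ isT)/andP[].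
have cvF : {ptws, Fil --> (clin_fun L : X -> Y)}.
  apply/pointwise_cvgP => t O Ot.
  have [eps eps0 epsO] := nbhs_segment e Ot.
  (* one point suffices for the convergence at t *)
  exists ([:: t], eps) => //= g [xi xi_lt gE] /=.
  by rewrite gE; apply: epsO; apply: xi_lt; rewrite inE.
have [[xs eps] /= eps0 WB] := cvF B nB.
exists xs, eps; split=> // xi L' xi_lt L'E; apply: BA; apply: WB.
by exists xi.
Qed.

Lemma clinear_eval_continuous (R : realType) (X Y : tvsType R) (x : X) :
  continuous (fun L : clinear X Y => L x).
Proof.
move=> L O Ot.
have := @initial_continuous _ {ptws X -> Y} (@clin_fun R X Y) L.
move=> /pointwise_cvgP/(_ x) H; exact: (H (fmap_filter (@clin_fun R X Y) (nbhs_filter L)) O Ot).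
Qed.

(** * Weak suprema *)

Section WeakSupremum.
Context (R : realType) (Y : tvsType R) (K : set Y).
Hypotheses (K_closed : closed K) (K_convex : convex_set K) (K_cone : is_cone K).

Lemma wlt_EFin (a b : Y) : wlt K a%:E b%:E <-> K° (b - a).
Proof.
by split=> [[k Kk /= kE]|Kba]; [rewrite -opprB -kE opprK|exists (b - a); rewrite ?opprB].
Qed.

Lemma coneD x y : K x -> K y -> K (x + y).
Proof.
move=> Kx Ky; have /convex_setE/(_ x y (2^-1)) h := K_convex.
have -> : x + y = 2 *: (2^-1 *: x + (1 - 2^-1) *: y).
  rewrite scalerDr !scalerA mulfV// (_ : 2 * (1 - 2^-1) = 1) ?scale1r//.
  by field.
by apply: K_cone => //; apply: h => //; lra.
Qed.

Lemma int_coneDr x k : K° x -> K k -> K° (x + k).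
Proof.
move=> Kx Kk.
have c : continuous (fun z : Y => z - k).
  apply: tvs_continuousB; last exact: cst_continuous.
  by move=> z; exact: cvg_id.
have nK : nbhs (x + k - k) K by rewrite addrK.
have n : nbhs (x + k) [set z | K (z - k)] := c (x + k) _ nK.
suff : nbhs (x + k) K by [].
by apply: filterS n => z Kz; rewrite -(subrK k z); exact: coneD.
Qed.

Lemma int_coneZ x (t : R) : 0 < t -> K° x -> K° (t *: x).
Proof.
move=> t0 Kx; have n : nbhs (t *: x) ( *:%R t @` K).
  by apply: nbhsZ => //; rewrite gt_eqF.
suff : nbhs (t *: x) K by [].
by apply: filterS n => _ [k Kk <-]; exact: K_cone.
Qed.

Lemma int_cone_absorbs k y : K° k -> exists2 t : R, 0 < t & K° (k + t *: y).
Proof.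
by move=> Kk; apply: nbhs_line; apply: open_nbhs_nbhs; split=> //; exact: open_interior.
Qed.

Lemma int_cone_absorbs_scaled k y : K° k -> exists2 t : R, 0 < t & K° (t *: k + y).
Proof.
move=> /int_cone_absorbs-/(_ y)[t t0 Kt]; exists t^-1; first by rewrite invr_gt0.
have -> : t^-1 *: k + y = t^-1 *: (k + t *: y).
  by rewrite scalerDr scalerA mulVf ?gt_eqF// scale1r.
by apply: int_coneZ; rewrite ?invr_gt0.
Qed.

(** A closed cone contains 0 as the limit of e k for e tending to 0+;
    the definition of a cone only provides positive multiples. *)
Lemma cone0 : K !=set0 -> K 0.
Proof.
move=> [k Kk]; apply: K_closed => O nO.
have [e e0 Oe] : exists2 e : R, 0 < e & O (0 + e *: k) by exact: nbhs_line.
by exists (e *: k); split; [exact: K_cone|rewrite add0r in Oe].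
Qed.

Section Line.
Context (M : set (\bar Y)) (e y : Y).
Hypotheses (Ke : K° e) (Mfin : exists u : Y, M u%:E) (Mpoo : ~ M +oo%E)
  (Mbd : exists y0 : Y, forall u, M u -> ~ wlt K y0%:E u).

(** Along the line y + t e the lower set of M is an open half-line, bounded
    above because M is; its endpoint t is in the weak supremum. The sign of t
    records on which side of this endpoint y lies: at or below it if y is in M,
    at or above it if y is not below any element of M. *)
Lemma WSup_line : exists t : R, [/\ WSup K M (y + t *: e)%:E,
  M y%:E -> 0 <= t & (forall u, M u -> ~ wlt K y%:E u) -> t <= 0].
Proof.
pose D := [set t : R | exists2 u : Y, M u%:E & K° (u - (y + t *: e))].
have Ke0 t : 0 < t -> K° (t *: e) by move=> t0; exact: int_coneZ.
have Ddown s t : s <= t -> D t -> D s.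
  rewrite le_eqVlt => /predU1P[->//|st] [u Mu Ku]; exists u => //.
  have -> : u - (y + s *: e) = u - (y + t *: e) + (t - s) *: e.
    by rewrite scalerBl !opprD !addrA subrK.
  by apply: int_coneDr => //; apply: interior_subset; apply: Ke0; lra.
have supD : has_sup D.
  split.
    have [u Mu] := Mfin; have [t t0 Kt] := int_cone_absorbs_scaled (u - y) Ke.
    exists (- t), u => //.
    by rewrite scaleNr opprD opprK addrA addrC.
  have [y0 y0P] := Mbd; have [s s0 Ks] := int_cone_absorbs_scaled (y - y0) Ke.
  exists s => t [u Mu Ku]; rewrite leNgt; apply/negP => st.
  apply: (y0P _ Mu); apply/wlt_EFin.
  have -> : u - y0 = u - (y + t *: e) + (s *: e + (y - y0) + (t - s) *: e).
    have -> : s *: e + (y - y0) + (t - s) *: e = y + t *: e - y0.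
      by rewrite scalerBl addrAC (addrC (s *: e)) subrK addrCA addrA.
    by rewrite addrA subrK.
  apply: int_coneDr => //; apply: coneD; first exact: interior_subset.
  by apply: interior_subset; apply: Ke0; lra.
pose t0 := sup D.
have nDt0 : ~ D t0.
  move=> [u Mu Ku]; have [s s0 Ks] := int_cone_absorbs (- e) Ku.
  suff : D (t0 + s) by move=> /(ub_le_sup supD.2); rewrite -/t0; lra.
  by exists u => //; rewrite scalerDl addrA opprD addrA -scalerN.
have Dlt t : t < t0 -> D t.
  move=> tt0; have tt0' : 0 < t0 - t by lra.
  have [s Ds ts] := sup_adherent tt0' supD.
  by apply: Ddown Ds; rewrite -/t0 in ts; lra.
exists t0; split.
- split.
    move=> [u| |] Mu //.
    by move/wlt_EFin => Ku; apply: nDt0; exists u.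
  move=> [w| |] // wt.
    move: wt => /wlt_EFin Kw; have [s s0 Ks] := int_cone_absorbs (- e) Kw.
    have /Dlt[u Mu Ku] : t0 - s < t0 by lra.
    exists u%:E => //; apply/wlt_EFin.
    have -> : u - w = (u - (y + (t0 - s) *: e)) + (y + t0 *: e - w + s *: - e).
      have -> : y + t0 *: e - w + s *: - e = y + (t0 - s) *: e - w.
        by rewrite scalerN scalerBl addrAC addrA.
      by rewrite addrA subrK.
    by apply: int_coneDr => //; exact: interior_subset.
  by have [u Mu] := Mfin; exists u%:E.
- move=> My; rewrite leNgt; apply/negP => t00.
  suff : D (t0 / 2) by move=> /(ub_le_sup supD.2); rewrite -/t0; lra.
  exists y => //; rewrite opprD addrA subrr add0r -scaleNr.
  by apply: Ke0; lra.
- move=> yP; rewrite leNgt; apply/negP => /Dlt[u Mu].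
  by rewrite scale0r addr0 => Ku; apply: (yP _ Mu); apply/wlt_EFin.
Qed.

End Line.

End WeakSupremum.

(** * Epigraphs of conjugate maps *)

Section Conjugates.
Context (R : realType) (X Y : tvsType R) (K : set Y).
Hypotheses (K_closed : closed K) (K_convex : convex_set K) (K_cone : is_cone K)
  (K_int : K° !=set0).

(** If y is not strictly below any value, [WSup_line] moves it down along e to
    a point of the weak supremum. *)
Lemma epi_conjugateE (F : X -> \bar Y) (L : clinear X Y) (y : Y) :
  (forall x, F x <> -oo%E) -> (exists x f, F x = f%:E) ->
  epi_conjugate K F (L, y) <->
  forall x f, F x = f%:E -> ~ K° (L x - f - y).
Proof.
move=> Foo [x0 [f0 Fx0]].
split=> [[v [vub _] [k Kk /= yE]] x f Fx Ki|epiP].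
  case: v vub yE => [v| |] vub //= [yE].
  apply: (vub (L x - f)%:E); first by exists x => //; rewrite Fx.
  apply/wlt_EFin; have -> : L x - f - v = L x - f - y + k.
    by rewrite yE opprD addrA subrK.
  exact: int_coneDr.
have [e Ke] := K_int.
have Kk0 : K 0 by apply: cone0 => //; exists e; exact: interior_subset.
have ub u : range (fun x => ((L x)%:E - F x)%E) u -> ~ wlt K y%:E u.
  move=> [x _ <-]; case Fx: (F x) => [f| |] //=; last by have := Foo x.
  by move=> /wlt_EFin; exact: epiP.
have [||t [Wt _ tle]] := @WSup_line R Y K K_convex K_cone _ e y Ke _ _
  (ex_intro _ y ub).
- by exists (L x0 - f0); exists x0 => //; rewrite Fx0.
- by move=> [x _]; case Fx: (F x) => [f| |] //; have := Foo x.
exists (y + t *: e)%:E => //; exists ((- t) *: e).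
  have := tle ub; rewrite le_eqVlt => /predU1P[->|t0].
    by rewrite oppr0 scale0r.
  by apply: K_cone; [rewrite oppr_gt0|exact: interior_subset].
by congr EFin; rewrite scaleNr addrK.
Qed.

(** By [epi_conjugateE] the complement is a union, over x, of preimages of
    the open set int K under continuous maps. *)
Lemma epi_conjugate_closed (F : X -> \bar Y) :
  (forall x, F x <> -oo%E) -> (exists x f, F x = f%:E) ->
  closed (epi_conjugate K F).
Proof.
move=> Foo Fdom [L y] clLy; apply/epi_conjugateE => // x f Fx Ki.
have c : continuous (fun p : clinear X Y * Y => p.1 x - f - p.2).
  apply: tvs_continuousB; last by move=> p; exact: cvg_snd.
  apply: tvs_continuousB; last exact: cst_continuous.
  move=> p; apply: (@continuous_comp _ _ _ fst (fun L : clinear X Y => L x)).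
    exact: cvg_fst.
  exact: clinear_eval_continuous.
have n : nbhs (L, y) [set p : clinear X Y * Y | K° (p.1 x - f - p.2)].
  apply: (c (L, y)); apply: open_nbhs_nbhs; split=> //; exact: open_interior.
have [[L' y'] [/epi_conjugateE h Ki']] := clLy _ n.
exact: (h Foo Fdom x f Fx Ki').
Qed.

(** Every element of a bounded set lies below an element of its weak
    supremum: follow a direction of int K upwards until the boundary. *)
Lemma dominated_WSup (M : set (\bar Y)) (u : Y) : M u%:E -> ~ M +oo%E ->
  (exists y0 : Y, forall u, M u -> ~ wlt K y0%:E u) ->
  exists2 v : Y, WSup K M v%:E & K (v - u).
Proof.
move=> Mu Mpoo Mbd; have [e Ke] := K_int.
have Kk0 : K 0 by apply: cone0 => //; exists e; exact: interior_subset.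
have [|t [Wt tge _]] := @WSup_line R Y K K_convex K_cone M e u Ke _ Mpoo Mbd.
  by exists u.
exists (u + t *: e) => //; rewrite addrC addKr.
have := tge Mu; rewrite le_eqVlt => /predU1P[<-|t0]; first by rewrite scale0r.
by apply: K_cone => //; exact: interior_subset.
Qed.

End Conjugates.

(** * The conjugate of the indicator of -S *)

Section Indicator.
Context (R : realType) (Z Y : tvsType R) (S : set Z) (K : set Y).
Hypotheses (K_closed : closed K) (K_convex : convex_set K) (K_cone : is_cone K)
  (K_int : K° !=set0) (S0 : S 0).
Context (T : clinear Z Y) (T_pos : weakly_positive S K T).

Let M := range (fun z => ((T z)%:E - indicator Y [set (- s)%R | s in S] z)%E).

Lemma conj_indicator_cases u : M u -> u = -oo%E \/ exists2 s, S s & u = (T (- s))%:E.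
Proof.
move=> [z _ <-]; rewrite /indicator; case: ifPn => [/set_mem[s Ss <-]|_].
  by right; exists s => //=; rewrite -[LHS]/((T (- s) - 0)%:E) subr0.
by left.
Qed.

Lemma conj_indicator_value s : S s -> M (T (- s))%:E.
Proof.
move=> Ss; exists (- s) => //; rewrite /indicator mem_set; last by exists s.
by rewrite -[LHS]/((T (- s) - 0)%:E) subr0.
Qed.

(** Weak positivity of T is exactly the upper bound by 0 that keeps the weak
    supremum of T(-S) finite. *)
Lemma weakly_positive_bounded u : M u -> ~ wlt K 0%:E u.
Proof.
move=> /conj_indicator_cases[->//|[s Ss ->]] /wlt_EFin; rewrite subr0 => Ki.
have : (T @` S `&` [set - k | k in K°]) (T s).
  by split; [exists s|exists (T (- s)) => //; rewrite linearN opprK].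
by rewrite T_pos.
Qed.

Lemma weakly_positive_dominated s : S s ->
  exists2 v : Y, conjugate K (indicator Y [set - s | s in S]) T v%:E &
    K (v - T (- s)).
Proof.
move=> Ss; apply: dominated_WSup => //; first exact: conj_indicator_value.
- by move=> /conj_indicator_cases[|[]].
- by exists 0 => u; exact: weakly_positive_bounded.
Qed.

(** A half-space phi <= 0 that contains a set contains its weak supremum: a
    point v with phi v > 0 can be lowered to w < v with phi w = 0, and no
    element of the set lies strictly above w. *)
Lemma conj_indicator_le0 (phi : clinear Y R^o) (e : Y) v :
  (forall k, K° k -> 0 < phi k) -> K° e -> (forall s, S s -> phi (T (- s)) <= 0) ->
  conjugate K (indicator Y [set - s | s in S]) T v ->
  exists2 v0 : Y, v = v0%:E & phi v0 <= 0.
Proof.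
move=> phi_pos Ke T_neg [vub vlub]; case: v vub vlub => [v| |] vub vlub.
- exists v => //; rewrite leNgt; apply/negP => v0.
  have phie : 0 < phi e by exact: phi_pos.
  have [|u Mu] := vlub (v - (phi v / phi e) *: e)%:E.
    apply/wlt_EFin; rewrite opprD addrA subrr sub0r opprK.
    by apply: int_coneZ => //; rewrite divr_gt0.
  have [->//|[s Ss ->]] := conj_indicator_cases Mu.
  move=> /wlt_EFin/phi_pos.
  rewrite linearB linearB linearZ /= /GRing.scale /= divfK ?gt_eqF// subrr subr0.
  by rewrite ltNge T_neg.
- have [//|u Mu] := vlub 0%:E; by move/(weakly_positive_bounded Mu).
- by case: (vub _ (conj_indicator_value S0)).
Qed.

End Indicator.

(** * Scalarization of cone-convex maps *)

Section ConeConvex.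
Context (R : realType) (X Y : tvsType R) (K : set Y).
Hypotheses (K_convex : convex_set K) (K_cone : is_cone K) (K0 : K 0).

Lemma extended_adde0 (a : \bar Y) : (a + 0%:E)%E = a.
Proof. by case: a => [r| |] //; congr EFin; rewrite addr0. Qed.

Lemma epi_graph (F : X -> \bar Y) x y : F x = y%:E -> epi K F (x, y).
Proof. by move=> Fx; exists 0 => //=; rewrite Fx -[RHS]/((y + 0)%:E) addr0. Qed.

Lemma cone_convex_conv (F : X -> \bar Y) x1 x2 y1 y2 (t : R) :
  cone_convex K F -> 0 < t -> t < 1 -> F x1 = y1%:E -> F x2 = y2%:E ->
  exists2 y, F (t *: x1 + (1 - t) *: x2) = y%:E &
             K (t *: y1 + (1 - t) *: y2 - y).
Proof.
move=> /convex_setE Fc t0 t1 /epi_graph F1 /epi_graph F2.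
have [k Kk] := Fc _ _ t t0 t1 F1 F2.
rewrite /=; case: (F _) => [y| |] //= [yE]; exists y => //.
by rewrite yE addrAC subrr add0r.
Qed.

Lemma cone_convex_indicator (F : X -> \bar Y) (A : set X) :
  cone_convex K F -> convex_set A ->
  cone_convex K (fun x => F x + indicator Y A x)%E.
Proof.
move=> Fc /convex_setE Ac; apply/convex_setE => -[x1 y1] [x2 y2] t t0 t1.
have val x y : epi K (fun x => F x + indicator Y A x)%E (x, y) <->
    A x /\ epi K F (x, y).
  rewrite /epi /indicator /=; case: ifPn => [/set_mem Ax|/negP Ax].
    split=> [[k Kk]|[_ [k Kk]]].
      by rewrite extended_adde0 => yE; split=> //; exists k.
    by move=> yE; exists k => //; rewrite extended_adde0.
  by split=> [[k Kk]|[/mem_set//]]; case: (F x).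
move=> /val[A1 F1] /val[A2 F2]; apply/val; split; first exact: Ac.
by move/convex_setE: Fc => /(_ _ _ t t0 t1 F1 F2).
Qed.

(** The set of all H x - L x + y + int K is open, convex and misses 0 by
    hypothesis; phi is a functional positive on it. Adding large multiples of k
    in int K shows phi k >= 0, strictly since int K is open; adding small
    multiples gives the inequality for H itself. *)
Lemma scalarization (H : X -> \bar Y) (L : clinear X Y) (y : Y) :
  cone_convex K H -> K° !=set0 -> (exists x h, H x = h%:E) ->
  (forall x h, H x = h%:E -> ~ K° (L x - h - y)) ->
  exists phi : clinear Y R^o, (forall k, K° k -> 0 < phi k) /\
    forall x h, H x = h%:E -> phi (L x) - phi h <= phi y.
Proof.
move=> Hc [e Ke] [x0 [h0 Hx0]] Hy.
pose a x h := h - L x + y.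
pose O := [set w | exists x h, H x = h%:E /\ K° (w - a x h)].
have KD k k' : K° k -> K° k' -> K° (k + k').
  by move=> Kk Kk'; apply: int_coneDr => //; exact: interior_subset.
have KZ (t : R) k : 0 < t -> K° k -> K° (t *: k) by exact: int_coneZ.
have Oa x h k : H x = h%:E -> K° k -> O (a x h + k).
  by move=> Hx Kk; exists x, h; split=> //; rewrite addrC addKr.
have [||||phi phiO] := @open_convex_separation R Y O.
- rewrite openE => w [x [h [Hx Kw]]].
  have c : continuous (fun z : Y => z - a x h).
    apply: tvs_continuousB; last exact: cst_continuous.
    by move=> z; exact: cvg_id.
  have n : nbhs w [set z | K° (z - a x h)].
    by apply: (c w); apply: open_nbhs_nbhs; split=> //; exact: open_interior.
  suff : nbhs w O by [].
  by apply: filterS n => z Kz; exists x, h.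
- apply/convex_setE => w1 w2 t t0 t1 [x1 [h1 [H1 K1]]] [x2 [h2 [H2 K2]]].
  have [h Hx Kh] := cone_convex_conv Hc t0 t1 H1 H2.
  exists (t *: x1 + (1 - t) *: x2), h; split=> //.
  have -> : t *: w1 + (1 - t) *: w2 - a (t *: x1 + (1 - t) *: x2) h =
     t *: (w1 - a x1 h1) + (1 - t) *: (w2 - a x2 h2)
     + (t *: h1 + (1 - t) *: h2 - h).
    have aE : a (t *: x1 + (1 - t) *: x2) h =
        t *: a x1 h1 + (1 - t) *: a x2 h2 - (t *: h1 + (1 - t) *: h2 - h).
      have -> : t *: a x1 h1 + (1 - t) *: a x2 h2 =
          t *: h1 + (1 - t) *: h2 - L (t *: x1 + (1 - t) *: x2) + y.
        rewrite [L _]linearD !linearZ /a /= !scalerDr !scalerN addrACA -scalerDl.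
        rewrite (_ : t + (1 - t) = 1); last by ring.
        by rewrite scale1r addrACA -opprD.
      move: (t *: h1 + (1 - t) *: h2) => H12.
      by rewrite /a opprB [RHS]addrC !addrA subrK.
    rewrite aE; move: (a x1 h1) (a x2 h2) (_ - h) => a1 a2 d.
    by rewrite opprB !scalerBr (addrACA (t *: w1) (- _)) -opprD addrCA [RHS]addrC.
  by apply: int_coneDr => //; apply: KD; apply: KZ => //; lra.
- by exists (a x0 h0 + e); exact: Oa.
- move=> [x [h [Hx]]]; rewrite sub0r /a => Kx; apply: (Hy x h Hx).
  by rewrite opprD opprB in Kx.
have phi_ge0 k : K° k -> 0 <= phi k.
  move=> Kk; rewrite leNgt; apply/negP => k0.
  (* the multiple of k that would make phi negative at a point of O *)
  pose s := (`|phi (a x0 h0)| + 1) / - phi k.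
  have s0 : 0 < s by rewrite divr_gt0// ?oppr_gt0// ltr_wpDl.
  have := phiO _ (Oa x0 h0 _ Hx0 (KZ s k s0 Kk)).
  rewrite linearD linearZ /= /GRing.scale /= /s invrN mulrN mulNr divfK ?lt_eqF//.
  by have := ler_norm (phi (a x0 h0) : R); lra.
have phi_gt0 k : K° k -> 0 < phi k.
  move=> Kk; pose d := a x0 h0 + e.
  have d0 : 0 < phi d by apply: phiO; exact: Oa.
  have [s s0 /phi_ge0] := int_cone_absorbs (- d) Kk.
  rewrite linearD linearZ linearN /= /GRing.scale /= => h.
  by have := mulr_gt0 s0 d0; lra.
exists phi; split=> // x h Hx; rewrite leNgt; apply/negP => yx.
have e0 : 0 < phi e by exact: phi_gt0.
(* the multiple of e that brings phi down to 0 at a point of O *)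
pose s := (phi (L x) - phi h - phi y) / phi e.
have s0 : 0 < s by rewrite divr_gt0//; lra.
have := phiO _ (Oa x h _ Hx (KZ s e s0 Ke)).
rewrite /a !linearD linearN linearZ /= /GRing.scale /= /s divfK ?gt_eqF//.
lra.
Qed.

End ConeConvex.

(** * The scalarized perturbation epigraph *)

(** Lower semicontinuity in the form of a closed epigraph, with the epigraph
    parametrized so that f may depend on one coordinate of t and the bound on
    all of them. *)
Lemma closed_sublevel (R : realType) (T X : topologicalType) (f : X -> \bar R)
    (pi : T -> X) (g : T -> R^o) :
  lower_semicontinuous f -> continuous pi -> continuous g ->
  closed [set t | (f (pi t) <= (g t)%:E)%E].
Proof.
move=> flsc cpi cg; rewrite -openC openE => t /= /negP; rewrite -ltNge => gf.
have [a ga af] : exists2 a : R, g t < a & (a%:E < f (pi t))%E.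
  case: (f (pi t)) gf => [r| |] //=.
    rewrite lte_fin => gr; exists ((g t + r) / 2); rewrite ?lte_fin; lra.
  by move=> _; exists (g t + 1); rewrite ?ltry//; lra.
have [V nV Vf] := flsc _ _ af.
have n1 : nbhs t [set s | V (pi s)] := cpi t V nV.
have n2 : nbhs t [set s | (g s : R) < a].
  by apply: (cg t [set r | (r : R) < a]); exact: lt_nbhsl.
suff : nbhs t (~` [set t | (f (pi t) <= (g t)%:E)%E]) by [].
apply: filterS (filterI n1 n2) => s [/Vf fs gs] /=.
by apply/negP; rewrite -ltNge; apply: lt_trans fs; rewrite lte_fin.
Qed.

Section Perturbation.
Context (R : realType) (X Y Z : tvsType R) (K : set Y) (S : set Z).
Context (C : set X) (F : X -> \bar Y) (G : X -> \bar Z).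
Hypothesis K0 : K 0.

(** With this reading as a slice of the S-epigraph, the convexity of the
    feasible set follows from that of C and of epi_S G. *)
Lemma feasibleE x : feasible C G S x <-> C x /\ epi S G (x, 0).
Proof.
rewrite /feasible /epi /=; split.
  move=> [Cx [_ [s Ss <-] GE]]; split=> //; exists s => //.
  by rewrite -GE; congr EFin; rewrite addNr.
move=> [Cx [s Ss]]; case Gx: (G x) => [g| |] //= [gs].
split=> //; exists g; last by [].
by exists s => //; apply/esym/eqP; rewrite -addr_eq0 -gs.
Qed.

Lemma feasible_convex : convex_set C -> cone_convex S G ->
  convex_set (feasible C G S).
Proof.
move=> /convex_setE Cc /convex_setE Gc; apply/convex_setE => x1 x2 t t0 t1.
move=> /feasibleE[C1 G1] /feasibleE[C2 G2]; apply/feasibleE.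
split; first exact: Cc.
have := Gc _ _ t t0 t1 G1 G2.
have -> // : t *: (x1, 0) + (1 - t) *: (x2, 0) =
  (t *: x1 + (1 - t) *: x2, 0) :> X * Z.
by apply: injective_projections; rewrite /= ?scaler0 ?scaler0 ?addr0.
Qed.

(** The epigraph of the perturbation function
      (x, z) |-> phi (F x) - phi (L x) + phi y  if x in C and z in G x + S,
    with value +oo elsewhere. Working with epi_S G rather than with zeta o G is
    what makes the set closed: the composites need not be lower
    semicontinuous. *)
Definition scalarized_epi (phi : clinear Y R^o) (L : clinear X Y) (y : Y) :
    set (X * Z * R^o) :=
  [set p | [/\ C p.1.1, epi S G p.1 &
    (er_map phi (F p.1.1) <= ((p.2 : R) + phi (L p.1.1) - phi y)%:E)%E]].

Lemma scalarized_epi_closed (phi : clinear Y R^o) L y : closed C -> epi_closed S G ->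
  lower_semicontinuous (er_map (phi : Y -> R) \o F) ->
  closed (scalarized_epi phi L y).
Proof.
move=> Ccl Gcl Fl.
have -> : scalarized_epi phi L y =
  (fun p => p.1.1) @^-1` C `&` (fst @^-1` epi S G `&`
  [set p | ((er_map phi \o F) p.1.1 <= ((p.2 : R) + phi (L p.1.1) - phi y)%:E)%E]).
  by apply/seteqP; split=> p /=; [move=> []|move=> [? []]].
have c1 : continuous (fun p : X * Z * R^o => p.1) by move=> p; exact: cvg_fst.
have c11 : continuous (fun p : X * Z * R^o => p.1.1).
  move=> p; apply: (@continuous_comp _ _ _ fst fst); first exact: cvg_fst.
  exact: cvg_fst.
apply: closedI; first by apply: closed_comp => // p _; exact: c11.
apply: closedI; first by apply: closed_comp => // p _; exact: c1.
apply: (@closed_sublevel R _ X _ (fun p => p.1.1)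
  (fun p => (p.2 : R^o) + phi (L p.1.1) - phi y)) => //.
apply: tvs_continuousB; last exact: cst_continuous.
apply: tvs_continuousD; first by move=> p; exact: cvg_snd.
move=> p; apply: (@continuous_comp _ _ _ (fun p : X * Z * R^o => L p.1.1) phi).
  apply: (@continuous_comp _ _ _ (fun p : X * Z * R^o => p.1.1) L).
    exact: c11.
  exact: clinear_continuous.
exact: clinear_continuous.
Qed.

Lemma scalarized_epi_convex (phi : clinear Y R^o) L y : convex_set C -> cone_convex S G ->
  cone_convex K F -> ~ range F -oo%E -> (forall k, K k -> 0 <= phi k) ->
  convex_set (scalarized_epi phi L y).
Proof.
move=> /convex_setE Cc /convex_setE Gc Fc Foo phi0.
apply/convex_setE => -[[x1 z1] r1] [[x2 z2] r2] t t0 t1 [/= C1 G1 F1] [/= C2 G2 F2].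
split => /=; first exact: Cc.
  exact: (Gc _ _ t t0 t1 G1 G2).
case F1E: (F x1) F1 => [f1| |] //=; last by case: Foo; exists x1.
case F2E: (F x2) F2 => [f2| |] //=; last by case: Foo; exists x2.
rewrite !lee_fin => F1 F2.
have [f -> Kf] := cone_convex_conv K0 Fc t0 t1 F1E F2E.
have := phi0 _ Kf; rewrite /= lee_fin !linearB !linearD !linearZ /= /GRing.scale /=.
nra.
Qed.

End Perturbation.

(** * The two inclusions *)

Section RankOne.
Context (R : realType) (X Y : tvsType R).

Lemma rank_one_exists (xi : clinear X R^o) (e : Y) :
  exists L : clinear X Y, forall x, L x = xi x *: e.
Proof.
apply: clinear_exists.
  by move=> a u v; rewrite linearD linearZ /= scalerDl scalerA.
apply: tvs_continuousZ; last exact: cst_continuous.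
exact: clinear_continuous.
Qed.

End RankOne.

Section Characterization.
Context (R : realType) (X Y Z : tvsType R) (K : set Y) (S : set Z).
Hypotheses (K_closed : closed K) (K_convex : convex_set K) (K_cone : is_cone K)
  (K_int : K° !=set0) (S0 : S 0).
Context (C : set X) (F : X -> \bar Y) (G : X -> \bar Z).
Hypotheses (F_proper : ~ range F -oo%E) (G_proper : ~ range G -oo%E).

Let FA x := (F x + indicator Y (feasible C G S) x)%E.
Let FCG (T : clinear Z Y) x := (F x + indicator Y C x + er_map T (G x))%E.

Lemma feasible_sumE x f :
  FA x = f%:E <-> feasible C G S x /\ F x = f%:E.
Proof.
rewrite /FA /indicator; case: ifPn => [/set_mem Ax|/negP Ax].
  by rewrite extended_adde0; split=> [|[]].
by split=> [|[/mem_set//]]; case: (F x).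
Qed.

Lemma lagrangian_sumE T x f : FCG T x = f%:E <->
  C x /\ exists a g, [/\ F x = a%:E, G x = g%:E & f = a + T g].
Proof.
rewrite /FCG /indicator; case: ifPn => [/set_mem Cx|/negP Cx].
  rewrite extended_adde0; split.
    case: (F x) => [a| |]; case: (G x) => [g| |] //= [<-].
    by split=> //; exists a, g.
  by move=> [_ [a [g [-> -> ->]]]].
split=> [|[/mem_set//]].
by case: (F x) => [a| |]; case: (G x) => [g| |].
Qed.

Lemma sum_neq_noo (a b : \bar Y) : a <> -oo%E -> b <> -oo%E -> (a + b)%E <> -oo%E.
Proof. by case: a b => [a| |] [b| |]. Qed.

Lemma F_noo x : F x <> -oo%E.
Proof. by move=> Fx; apply: F_proper; exists x. Qed.

Lemma G_noo x : G x <> -oo%E.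
Proof. by move=> Gx; apply: G_proper; exists x. Qed.

Lemma indicator_noo (A : set X) x : indicator Y A x <> -oo%E.
Proof. by rewrite /indicator; case: ifP. Qed.

Lemma feasible_sum_noo x : FA x <> -oo%E.
Proof. by apply: sum_neq_noo; [exact: F_noo|exact: indicator_noo]. Qed.

Lemma lagrangian_noo T x : FCG T x <> -oo%E.
Proof.
apply: sum_neq_noo.
  by apply: sum_neq_noo; [exact: F_noo|exact: indicator_noo].
by case: (G x) (@G_noo x).
Qed.

Hypothesis A_dom : (feasible C G S `&` edom F) !=set0.

Lemma feasible_point : exists x f, feasible C G S x /\ F x = f%:E.
Proof.
have [x [Ax]] := A_dom; rewrite /edom /=.
by case Fx: (F x) (@F_noo x) => [f| |] // _ _; exists x, f.
Qed.

Lemma feasible_value x : feasible C G S x ->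
  C x /\ exists2 s, S s & G x = (- s)%:E.
Proof. by move=> [Cx [_ [s Ss <-] GE]]; split=> //; exists s. Qed.

Lemma feasible_dom : exists x f, FA x = f%:E.
Proof. by have [x [f xf]] := feasible_point; exists x, f; exact/feasible_sumE. Qed.

Lemma lagrangian_dom T : exists x f, FCG T x = f%:E.
Proof.
have [x [f [/feasible_value[Cx [s Ss Gx]] Fx]]] := feasible_point.
exists x, (f + T (- s)); apply/lagrangian_sumE; split=> //.
by exists f, (- s).
Qed.

(** At a feasible x, the condition attached to a v in I_{-S}^*(T) that
    dominates T (G x) is at least as strong as the one required without
    multiplier: the terms T (G x) and v cancel up to an element of K. *)
Lemma multiplier_sub (T : clinear Z Y) : weakly_positive S K T ->
  \bigcap_(v in conjugate K (indicator Y [set - s | s in S]) T)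
     translate (epi_conjugate K (FCG T)) (0, v) `<=` epi_conjugate K FA.
Proof.
move=> T_pos [L y] Ly; apply/epi_conjugateE => //.
- exact: feasible_sum_noo.
- exact: feasible_dom.
move=> x f /feasible_sumE[/feasible_value[Cx [s Ss Gx]] Fx] Ki.
have [v cv Kv] := weakly_positive_dominated K_closed K_convex K_cone K_int T_pos Ss.
have [[L' y'] /= qP [LE yE]] := Ly _ cv.
rewrite addr0 in LE; subst L'.
move: yE => [yE].
have /epi_conjugateE h := qP.
apply: (h _ _ _ _ _ _ x (f + T (- s))) => //.
- exact: lagrangian_noo.
- exact: lagrangian_dom.
- by apply/lagrangian_sumE; split=> //; exists f, (- s).
have -> : L x - (f + T (- s)) - y' = L x - f - y + (v - T (- s)).
  rewrite yE !opprD !addrA subrK.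
  by rewrite -!addrA; congr (_ + (_ + _)); rewrite addrC.
exact: int_coneDr.
Qed.

(** After applying phi, an element of int K would have a positive image,
    while the displayed inequality and phi v <= 0 make it nonpositive. *)
Lemma multiplier_in (phi : clinear Y R^o) (e : Y) (zeta : clinear Z R^o)
    (T : clinear Z Y) (L : clinear X Y) (y : Y) :
  (forall k, K° k -> 0 < phi k) -> K° e ->
  (forall s, S s -> 0 <= zeta s) -> (forall z, phi (T z) = zeta z) ->
  (forall x f g, C x -> F x = f%:E -> G x = g%:E ->
     phi (L x) - phi f - zeta g <= phi y) ->
  weakly_positive S K T /\
  (\bigcap_(v in conjugate K (indicator Y [set - s | s in S]) T)
     translate (epi_conjugate K (FCG T)) (0, v)) (L, y).
Proof.
move=> phi_pos Ke zeta0 TE LyP.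
have T_pos : weakly_positive S K T.
  apply/seteqP; split=> // _ [[s Ss <-] [k Kk kT]].
  have := phi_pos _ Kk; rewrite -[k]opprK kT linearN /= TE.
  by have := zeta0 _ Ss; lra.
split=> // v cv.
have [|v0 -> phiv] := conj_indicator_le0 K_cone S0 T_pos phi_pos Ke _ cv.
  by move=> s Ss; rewrite TE linearN oppr_le0; exact: zeta0.
exists (L, y - v0); last first.
  by split=> /=; [rewrite addr0|congr EFin; rewrite subrK].
apply/epi_conjugateE => //.
- exact: lagrangian_noo.
- exact: lagrangian_dom.
move=> x h /lagrangian_sumE[Cx [f [g [Fx Gx ->]]]] /phi_pos.
rewrite !linearB /= [phi (f + _)]linearD /= TE; have := LyP x f g Cx Fx Gx.
lra.
Qed.

End Characterization.

Theorem theorem3p14 (R : realType) (X Y Z : tvsType R)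
  (hausX : hausdorff_space X) (hausY : hausdorff_space Y)
  (hausZ : hausdorff_space Z)
  (K : set Y) (K_closed : closed K) (K_pointed : pointed_cone K)
  (K_convex : convex_set K) (K_cone : is_cone K) (K_int : K° !=set0)
  (S : set Z) (S_neq0 : S !=set0) (S_closed : closed S)
  (S_convex : convex_set S) (S_cone : is_cone S)
  (C : set X) (C_neq0 : C !=set0) (C_closed : closed C)
  (C_convex : convex_set C)
  (F : X -> \bar Y) (F_proper : proper_map F) (F_convex : cone_convex K F)
  (F_lsc : forall ystar : clinear Y R^o,
    lower_semicontinuous (er_map (ystar : Y -> R) \o F))
  (G : X -> \bar Z) (G_proper : proper_map G) (G_convex : cone_convex S G)
  (G_closed : epi_closed S G)
  (A_dom : (feasible C G S `&` edom F) !=set0) :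
  epi_conjugate K (fun x => F x + indicator Y (feasible C G S) x)%E
  = closure
      (\bigcup_(T in weakly_positive S K)
         \bigcap_(v in conjugate K (indicator Y [set - s | s in S]) T)
           translate
             (epi_conjugate K
                (fun x => F x + indicator Y C x + er_map T (G x))%E)
             (0, v)).
Proof.
have S0 : S 0 by exact: cone0.
have K0 : K 0.
  by apply: cone0 => //; case: K_int => k Kk; exists k; exact: interior_subset.
have [_ Foo] := F_proper; have [_ Goo] := G_proper.
apply/seteqP; split; last first.
  rewrite closureE => p; apply; split.
    by apply: epi_conjugate_closed => //; [exact: feasible_sum_noo|exact: feasible_dom].
  by move=> q [T T_pos]; exact: multiplier_sub.
move=> [L y] /epi_conjugateE Ly U [[A B] /= [nA nB] ABU].
have {}Ly := Ly K_closed K_convex K_cone K_int (@feasible_sum_noo _ _ _ _ _ _ _ _ Foo) (feasible_dom Foo A_dom).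
have FA_convex := cone_convex_indicator F_convex (feasible_convex C_convex G_convex).
have [phi [phi_pos phiL]] := scalarization K_convex K_cone K0 FA_convex K_int
  (feasible_dom Foo A_dom) Ly.
have [e0 Ke0] := K_int.
have [e Ke phie] : exists2 e : Y, K° e & phi e = 1.
  exists ((phi e0)^-1 *: e0).
    by apply: int_coneZ => //; rewrite invr_gt0 phi_pos.
  by rewrite linearZ /= /GRing.scale /= mulVf// gt_eqF// phi_pos.
have phi_ge0 k : K k -> 0 <= phi k.
  move=> Kk; rewrite leNgt; apply/negP => k0.
  have : K° (- (phi k) *: e + k) by apply: int_coneDr => //; apply: int_coneZ => //; rewrite oppr_gt0.
  by move/phi_pos; rewrite linearD linearZ /= phie /GRing.scale /=; lra.
have [xs [eps1 [eps1_gt0 nearL]]] := nbhs_pointwise e nA.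
have [eps2 eps2_gt0 neary] := nbhs_segment e nB.
pose eps := Num.min eps1 (eps2 / 2).
have eps_gt0 : 0 < eps by rewrite lt_min eps1_gt0 divr_gt0.
(* scalar duality for phi o F, approximating to within eps both at the
   points xs and along e *)
pose E := scalarized_epi S C F G phi L y.
have [x0 [f0 [Ax0 Fx0]]] := feasible_point Foo A_dom.
have /feasibleE[Cx0 Gx0] := Ax0.
pose r0 : R := phi f0 - phi (L x0) + phi y.
have E0 : E (x0, 0, r0) by split=> //=; rewrite Fx0 /= lee_fin /r0; lra.
have [|||xi [zeta [minor xi_lt]]] := @affine_minorant R X Z E x0 r0 xs eps _ _ E0 _ eps_gt0.
- exact: scalarized_epi_closed.
- exact: (scalarized_epi_convex K0).
- move=> x r [/= Cx Gx]; case Fx: (F x) => [f| |] //=; last by case: Foo; exists x.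
  rewrite lee_fin.
  have /phiL : (F x + indicator Y (feasible C G S) x)%E = f%:E.
    by apply/feasible_sumE; split=> //; exact/feasibleE.
  lra.
have zeta_ge0 s : S s -> 0 <= zeta s.
  move=> Ss; rewrite leNgt; apply/negP => s0.
  (* the points (x0, t s, r0) are in E for all t > 0; this t would violate
     the affine minorant if zeta s < 0 *)
  pose t := (`|xi x0 - eps - r0| + 1) / - zeta s.
  have t0 : 0 < t by rewrite divr_gt0// ?oppr_gt0// ltr_wpDl.
  have Et : E (x0, t *: s, r0).
    case: E0 => /= ? _ ?; split=> //=.
    have [s1 Ss1 /= s1E] := Gx0; exists (s1 + t *: s).
      by apply: coneD => //; exact: S_cone.
    case: (G x0) s1E => [g| |] //= [g0]; congr EFin.
    by rewrite addrA -g0 add0r.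
  have := minor _ _ _ Et; rewrite linearZ /= /GRing.scale /= /t invrN mulrN mulNr divfK ?lt_eqF//.
  by have := ler_norm (- (xi x0 - eps - r0) : R); rewrite normrN; lra.
have [dL dLE] := rank_one_exists xi e.
have [T TE] := rank_one_exists zeta e.
have phiT z : phi (T z) = zeta z by rewrite TE linearZ /= phie; exact: mulr1.
pose L' : clinear X Y := L + dL.
have L'E x : L' x = L x + xi x *: e by rewrite -dLE.
pose y' := y + eps *: e.
have [|T_pos capT] := @multiplier_in R X Y Z K S K_closed K_convex K_cone K_int S0
  C F G Foo Goo A_dom phi e zeta T L' y' phi_pos Ke zeta_ge0 phiT.
  move=> x f g Cx Fx Gx; rewrite L'E /y' !linearD !linearZ /= phie.
  have : E (x, g, phi f - phi (L x) + phi y).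
    split=> //=; first by exists 0; rewrite //= Gx; congr EFin; rewrite addr0.
    by rewrite Fx /= lee_fin; lra.
  move/minor; rewrite /GRing.scale /=; lra.
exists (L', y'); split; first by exists T.
apply: ABU; split => /=.
  apply: (nearL xi) => // x /xi_lt h; apply: (lt_le_trans h).
  by rewrite ge_min lexx.
apply: neary; rewrite gtr0_norm//; apply: (@le_lt_trans _ _ (eps2 / 2)).
  by rewrite ge_min lexx orbT.
lra.
Qed.
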